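(* For all integers $m,n\ge 3$, $\mathrm{BSR}_{\mathrm{simple}}(m,n)\ge m+n$. Consequently, $\mathrm{BSR}(m,n)\ge m+n$ for all $m,n\ge 3$.
   Context: An $m\times n$ biquadratic form is a real polynomial $P(\mathbf{x},\mathbf{y})=\sum_{i,k=1}^{m}\sum_{j,l=1}^{n} a_{ijkl}x_ix_ky_jy_l$ in variables $\mathbf{x}=(x_1,\dots,x_m)$, $\mathbf{y}=(y_1,\dots,y_n)$. It is called simple if it is a sum of distinct terms of the type $x_i^2y_j^2$ (each with coefficient $1$), i.e. $P=\sum_{(i,j)\in E}x_i^2y_j^2$ for some nonempty set $E\subseteq\{1,\dots,m\}\times\{1,\dots,n\}$. A bilinear form is a polynomial $\sum_{i,j} c_{ij}x_iy_j$ with real coefficients. $P$ is SOS if it is a finite sum of squares of bilinear forms; its SOS rank $\operatorname{sos}(P)$ is the smallest number of squares of bilinear forms in such a representation. $\mathrm{BSR}_{\mathrm{simple}}(m,n)$ denotes the maximum of $\operatorname{sos}(P)$ over all simple $m\times n$ biquadratic forms $P$, and $\mathrm{BSR}(m,n)$ denotes the maximum of $\operatorname{sos}(P)$ over all SOS $m\times n$ biquadratic forms $P$. *)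

(* Defs.v *)
From mathcomp Require Import all_boot all_order all_algebra.
From mathcomp Require Import mpoly.
From mathcomp Require Import boolp classical_sets reals.

Set Implicit Arguments.
Unset Strict Implicit.
Unset Printing Implicit Defensive.

Import GRing.Theory.
Local Open Scope ring_scope.

(** Polynomials in x_1, .., x_m, y_1, .., y_n are elements of
    [{mpoly R[m + n]}]: the first [m] indeterminates are the x_i, the last [n]
    ones are the y_j. *)
Definition xvar (R : realType) (m n : nat) (i : 'I_m) : {mpoly R[m + n]} :=
  'X_(lshift n i).

Definition yvar (R : realType) (m n : nat) (j : 'I_n) : {mpoly R[m + n]} :=
  'X_(rshift m j).

Definition biquadratic_form (R : realType) (m n : nat)
    (P : {mpoly R[m + n]}) : Prop :=
  exists a : 'I_m -> 'I_n -> 'I_m -> 'I_n -> R,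
    P = \sum_(i < m) \sum_(k < m) \sum_(j < n) \sum_(l < n)
          a i j k l *: (xvar R n i * xvar R n k * yvar R m j * yvar R m l).

Definition simple_form (R : realType) (m n : nat)
    (P : {mpoly R[m + n]}) : Prop :=
  exists2 E : {set 'I_m * 'I_n}, E != finset.set0 &
    P = \sum_(e in E) xvar R n e.1 ^+ 2 * yvar R m e.2 ^+ 2.

Definition bilinear_form (R : realType) (m n : nat)
    (f : {mpoly R[m + n]}) : Prop :=
  exists c : 'I_m -> 'I_n -> R,
    f = \sum_(i < m) \sum_(j < n) c i j *: (xvar R n i * yvar R m j).

Definition sum_of_squares (R : realType) (m n : nat)
    (P : {mpoly R[m + n]}) (r : nat) : Prop :=
  exists2 f : 'I_r -> {mpoly R[m + n]},
    forall t, bilinear_form (f t) & P = \sum_(t < r) f t ^+ 2.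

Definition is_SOS (R : realType) (m n : nat) (P : {mpoly R[m + n]}) : Prop :=
  exists r, sum_of_squares P r.

Definition least_nat (A : set nat) (k : nat) : Prop :=
  A k /\ forall j, A j -> (k <= j)%N.

Definition greatest_nat (A : set nat) (k : nat) : Prop :=
  A k /\ forall j, A j -> (j <= k)%N.

(** Junk value [0] when [P] is not SOS. *)
Definition sos_rank (R : realType) (m n : nat) (P : {mpoly R[m + n]}) : nat :=
  xget 0%N (least_nat (sum_of_squares P)).

(** [BSR_simple] and [BSR] have the junk value [0] when the set of ranks has no
    greatest element; a positive lower bound on them therefore includes the
    existence of the maximum. *)
Definition BSR_simple (R : realType) (m n : nat) : nat :=
  xget 0%N (greatest_nat
    (fun r => exists2 P : {mpoly R[m + n]}, simple_form P & sos_rank P = r)).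

Definition BSR (R : realType) (m n : nat) : nat :=
  xget 0%N (greatest_nat
    (fun r => exists2 P : {mpoly R[m + n]},
       biquadratic_form P /\ is_SOS P & sos_rank P = r)).

(* Main.v *)
Require Import Defs.
From HB Require Import structures.
From mathcomp Require Import all_boot all_order all_algebra.
From mathcomp Require Import mpoly boolp reals ring lra.

(** Lower bound.  View [E] as the edge set of a bipartite graph.  In a
    representation of its simple form as a sum of [r] squares, let [c_ij] in
    R^r collect the coefficients of [x_i y_j] in the [r] bilinear forms.
    Comparing coefficients gives |c_ij|^2 = 1 or 0 according to whether (i, j)
    is an edge, and c_ij . c_kl + c_il . c_kj = 0 for (i, j) <> (k, l)
    ([gram_diag], [gram_polar]).  If [E] has no 4-cycle, one of c_il, c_kj
    vanishes whenever (i, j) and (k, l) are disjoint edges, so the c_e with e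
    in [E] are orthonormal in R^r and r >= #|E| ([C4_free_card_le]): the
    obvious representation is optimal.  The 6-cycle in K_(3,3), with each
    remaining vertex hung on it by a pendant edge, is a connected graph with
    exactly one cycle, of length 6; hence it is C4-free and has as many edges
    as vertices, namely m + n ([card_pendant_hexagon]).

    Existence of the maxima.  Bilinear forms span a space of dimension m * n.
    More than m * n of them are linearly dependent, and one that is a
    combination of the others can be absorbed into them without changing the
    sum of squares ([sum_sqr_absorb]).  So all SOS ranks are at most m * n, and
    both sets of ranks have a greatest element. *)

Set Implicit Arguments.
Unset Strict Implicit.
Unset Printing Implicit Defensive.

Import Order.TTheory GRing.Theory Num.Theory.
Local Open Scope ring_scope.

(** * At most m * n squares are needed *)

Definition bilmx (R : realType) (m n : nat) (A : 'M[R]_(m, n)) :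
    {mpoly R[m + n]} :=
  \sum_(i < m) \sum_(j < n) A i j *: (xvar R n i * yvar R m j).

Lemma bilmx_is_linear (R : realType) (m n : nat) : linear (@bilmx R m n).
Proof.
move=> a A B; rewrite /bilmx scaler_sumr -big_split; apply: eq_bigr => i _ /=.
rewrite scaler_sumr -big_split; apply: eq_bigr => j _ /=.
by rewrite !mxE scalerDl scalerA.
Qed.

HB.instance Definition _ (R : realType) (m n : nat) :=
  GRing.isLinear.Build R 'M[R]_(m, n) {mpoly R[m + n]} *:%R (@bilmx R m n)
    (@bilmx_is_linear R m n).

Lemma sum_of_squaresP (R : realType) (m n : nat) (P : {mpoly R[m + n]}) r :
  sum_of_squares P r <->
  exists C : 'I_r -> 'M[R]_(m, n), P = \sum_(t < r) bilmx (C t) ^+ 2.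
Proof.
split=> [[f fB ->]|[C ->]]; last first.
  by exists (fun t => bilmx (C t)) => // t; exists (C t).
have [c fE] := choice fB.
exists (fun t => \matrix_(i, j) c t i j); apply: eq_bigr => t _.
congr (_ ^+ 2); rewrite {1}fE /bilmx; apply: eq_bigr => i _.
by apply: eq_bigr => j _; rewrite mxE.
Qed.

(** As a quadratic form in [F], the left-hand side has matrix 1 + a^T a, whose
    square root is 1 + c (a^T a) where c solves c^2 |a|^2 + 2 c = 1; the
    right-hand side is the sum of squares of the rows of that root. *)
Lemma sum_sqr_absorb (R : realType) (A : comAlgType R) (I : finType)
    (F : I -> A) (a : I -> R) :
  let S := \sum_s a s *: F s in
  let c := (1 + Num.sqrt (1 + \sum_s a s ^+ 2))^-1 in
  \sum_s F s ^+ 2 + S ^+ 2 = \sum_s (F s + (c * a s) *: S) ^+ 2.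
Proof.
move=> S c.
have N0 : 0 <= \sum_s a s ^+ 2 by apply: sumr_ge0 => s _; apply: sqr_ge0.
have cE : c ^+ 2 * (\sum_s a s ^+ 2) + c * 2 = 1.
  rewrite /c; set N := \sum_s _ in N0 *.
  set q := Num.sqrt _; have q0 : 0 <= q by apply: sqrtr_ge0.
  have qE : N = q ^+ 2 - 1 by rewrite sqr_sqrtr; [ring|lra].
  by rewrite qE; field; rewrite gt_eqF //; lra.
have sqE s : (F s + (c * a s) *: S) ^+ 2 =
    F s ^+ 2 + ((c * 2) *: (S * (a s *: F s)) + (c ^+ 2 * a s ^+ 2) *: S ^+ 2).
  have algE k (x : A) : k *: x = in_alg A k * x by rewrite mulr_algl.
  by rewrite !algE !expr2 !rmorphM rmorph_nat; ring.
under [RHS]eq_bigr => s _ do rewrite sqE.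
rewrite big_split big_split /= -scaler_sumr -mulr_sumr -/S -expr2.
rewrite -scaler_suml -mulr_sumr -scalerDl; congr (_ + _).
by rewrite addrC cE scale1r.
Qed.

(** The [r + 1] coefficient matrices live in dimension [m * n <= r], so one of
    them is a combination of the others and its square can be absorbed. *)
Lemma fewer_squares (R : realType) (m n r : nat) (C : 'I_r.+1 -> 'M[R]_(m, n)) :
  (m * n <= r)%N ->
  exists B : 'I_r -> 'M[R]_(m, n),
    \sum_t bilmx (C t) ^+ 2 = \sum_t bilmx (B t) ^+ 2.
Proof.
move=> le_mn_r; pose M := \matrix_t mxvec (C t).
have /row_freePn[t0 /submxP[D MD]] : ~~ row_free M.
  by rewrite -row_leq_rank -ltnNge ltnS (leq_trans (rank_leq_col M)).
have Ct0 : C t0 = \sum_s D 0 s *: C (lift t0 s).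
  apply: (can_inj mxvecK); rewrite -[LHS](rowK (fun t => mxvec (C t))) MD.
  rewrite mulmx_sum_row linear_sum; apply: eq_bigr => s _ /=.
  by rewrite linearZ; congr (_ *: _); apply/rowP => k; rewrite !mxE.
have [a {}Ct0] : exists a : 'I_r -> R, C t0 = \sum_s a s *: C (lift t0 s).
  by exists (D 0).
pose S := \sum_s a s *: C (lift t0 s).
pose c := (1 + Num.sqrt (1 + \sum_s a s ^+ 2))^-1.
exists (fun s => C (lift t0 s) + (c * a s) *: S).
have SE : bilmx S = \sum_s a s *: bilmx (C (lift t0 s)).
  by rewrite linear_sum; apply: eq_bigr => s _; rewrite linearZ.
under [RHS]eq_bigr => s _ do rewrite linearD linearZ /= SE.
by rewrite -sum_sqr_absorb -SE (bigD1_ord t0) //= addrC Ct0.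
Qed.

Lemma sum_of_squares_bounded (R : realType) (m n : nat) (P : {mpoly R[m + n]})
    r :
  sum_of_squares P r -> exists2 s, (s <= m * n)%N & sum_of_squares P s.
Proof.
elim: r => [|r IHr] Pr; first by exists 0%N.
have [le_r|lt_r] := leqP r.+1 (m * n); first by exists r.+1.
apply: IHr; apply/sum_of_squaresP.
have /sum_of_squaresP[C ->] := Pr.
exact: (fewer_squares _).
Qed.

(** * Ranks and maxima are attained *)

Lemma sos_rankP (R : realType) (m n : nat) (P : {mpoly R[m + n]}) :
  is_SOS P -> least_nat (sum_of_squares P) (sos_rank P).
Proof.
move=> [r Pr]; apply: classical_sets.xgetPex.
have exP : exists k, `[< sum_of_squares P k >] by exists r; apply/asboolP.
exists (ex_minn exP); case: ex_minnP => k /asboolP Pk k_min.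
by split=> // j /asboolP; apply: k_min.
Qed.

Lemma sos_rank_le (R : realType) (m n : nat) (P : {mpoly R[m + n]}) :
  is_SOS P -> (sos_rank P <= m * n)%N.
Proof.
move=> SP; have [r /sum_of_squares_bounded[s le_s Ps]] := SP.
by apply: leq_trans le_s; have [_] := sos_rankP SP; apply.
Qed.

(** A bounded nonempty set of naturals has a greatest element, so the default
    value of [xget] is not reached. *)
Lemma le_xget_greatest (A : classical_sets.set nat) (b k : nat) :
  (forall j, A j -> (j <= b)%N) -> A k ->
  (k <= classical_sets.xget 0%N (greatest_nat A))%N.
Proof.
move=> ubA Ak.
suff [_ /(_ k Ak)] :
  greatest_nat A (classical_sets.xget 0%N (greatest_nat A)) by [].
apply: classical_sets.xgetPex.
have exA : exists j, `[< A j >] by exists k; apply/asboolP.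
have ubA' j : `[< A j >] -> (j <= b)%N by move/asboolP/ubA.
exists (ex_maxn exA ubA'); case: ex_maxnP => l /asboolP Al l_max.
by split=> // j /asboolP; apply: l_max.
Qed.

(** * Simple forms of C4-free graphs *)

Lemma meval_bilmx (R : realType) (m n : nat) (A : 'M[R]_(m, n))
    (u : 'rV[R]_m) (v : 'rV[R]_n) :
  (bilmx A).@[row_mx u v 0] = (u *m A *m v^T) 0 0.
Proof.
rewrite /bilmx raddf_sum mxE /=.
under [RHS]eq_bigr => j _ do rewrite !mxE mulr_suml.
rewrite [RHS]exchange_big; apply: eq_bigr => i _ /=.
rewrite raddf_sum; apply: eq_bigr => j _ /=.
by rewrite mevalZ rmorphM /= !mevalXU row_mxEl row_mxEr; ring.
Qed.

Lemma meval_simple (R : realType) (m n : nat) (E : {set 'I_m * 'I_n})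
    (u : 'rV[R]_m) (v : 'rV[R]_n) :
  (\sum_(e in E) xvar R n e.1 ^+ 2 * yvar R m e.2 ^+ 2).@[row_mx u v 0]
    = \sum_(e in E) u 0 e.1 ^+ 2 * v 0 e.2 ^+ 2.
Proof.
rewrite raddf_sum; apply: eq_bigr => e _ /=.
by rewrite rmorphM !rmorphXn /= !mevalXU row_mxEl row_mxEr.
Qed.

Definition C4_free (m n : nat) (E : {set 'I_m * 'I_n}) : Prop :=
  forall i j k l, i != k -> j != l -> (i, j) \in E -> (k, l) \in E ->
  ~~ (((i, l) \in E) && ((k, j) \in E)).

Section Gram.

Variables (R : realType) (m n r : nat) (E : {set 'I_m * 'I_n}).
Variable C : 'I_r -> 'M[R]_(m, n).
Hypothesis CE :
  \sum_(e in E) xvar R n e.1 ^+ 2 * yvar R m e.2 ^+ 2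
    = \sum_(t < r) bilmx (C t) ^+ 2.

Let gram_eval (u : 'rV[R]_m) (v : 'rV[R]_n) :
  \sum_(t < r) ((u *m C t *m v^T) 0 0) ^+ 2
    = \sum_(e in E) u 0 e.1 ^+ 2 * v 0 e.2 ^+ 2.
Proof.
rewrite -meval_simple CE raddf_sum; apply: eq_bigr => t _ /=.
by rewrite rmorphXn /= meval_bilmx.
Qed.

Lemma gram_diag i j : \sum_t C t i j ^+ 2 = ((i, j) \in E)%:R.
Proof.
have := gram_eval (delta_mx 0 i) (delta_mx 0 j).
under eq_bigr => t _ do rewrite trmx_delta -rowE -colE !mxE.
move=> ->; rewrite big_mkcond (bigD1 (i, j)) //= big1 ?addr0 => [|[k l]].
  by rewrite !mxE !eqxx; case: ifP => _ //; rewrite expr1n mulr1.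
rewrite xpair_eqE negb_and !mxE eqxx /= => /orP[]/negPf->;
  by case: ifP => // _; rewrite expr0n ?mul0r ?mulr0.
Qed.

(** This compares the coefficients of [x_i x_k y_j y_l], extracted by evaluating
    at x = e_i +- e_k and y = e_j +- e_l and taking the alternating sum over
    the signs.  On the simple form this sum vanishes, as x_p^2 is insensitive
    to the sign of e_k when i <> k.  The degenerate cases i = k and j = l are
    included: there the two products coincide, and the identity says that
    [c_ij] and [c_kl] are orthogonal. *)
Lemma gram_polar i j k l : (i, j) != (k, l) ->
  \sum_t (C t i j * C t k l + C t i l * C t k j) = 0.
Proof.
move=> ijkl.
pose u (a : R) : 'rV[R]_m := delta_mx 0 i + a *: delta_mx 0 k.
pose v (b : R) : 'rV[R]_n := delta_mx 0 j + b *: delta_mx 0 l.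
have evE a b t : (u a *m C t *m (v b)^T) 0 0 =
    C t i j + b * C t i l + a * C t k j + a * b * C t k l.
  rewrite /u /v linearD linearZ /= !trmx_delta mulmxDl -scalemxAl -!rowE.
  by rewrite mulmxDr -scalemxAr -!colE !mxE; ring.
pose H a b := \sum_(e in E) u a 0 e.1 ^+ 2 * v b 0 e.2 ^+ 2.
(* At each edge the alternating sum only retains the cross term of u^2 times
   that of v^2, and one of these is a product of incompatible deltas. *)
have H0 : H 1 1 - H (- 1) 1 - H 1 (- 1) + H (- 1) (- 1) = 0.
  rewrite /H -!sumrB -big_split big1 //= => -[k' l'] _ /=.
  rewrite !mxE !eqxx /=.
  pose p : R := (k' == i)%:R * (k' == k)%:R.
  pose q : R := (l' == j)%:R * (l' == l)%:R.
  transitivity (16 * p * q); first by rewrite /p /q; ring.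
  move: ijkl; rewrite xpair_eqE negb_and => /orP[ik|jl].
    suff -> : p = 0 by rewrite mulr0 mul0r.
    by rewrite /p; case: eqP => [->|_]; rewrite ?(negPf ik) ?mulr0 ?mul0r.
  suff -> : q = 0 by rewrite mulr0.
  by rewrite /q; case: eqP => [->|_]; rewrite ?(negPf jl) ?mulr0 ?mul0r.
suff : 8 * \sum_t (C t i j * C t k l + C t i l * C t k j) = 0 by lra.
rewrite -[RHS]H0 /H -!gram_eval mulr_sumr -!sumrB -[RHS]big_split.
apply: eq_bigr => t _ /=.
by rewrite !evE; ring.
Qed.

Lemma gram_notin t i j : (i, j) \notin E -> C t i j = 0.
Proof.
move=> ijE; have /eqP := gram_diag i j; rewrite (negPf ijE) psumr_eq0.
  by move=> /allP/(_ t (mem_index_enum _)); rewrite sqrf_eq0 => /eqP.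
by move=> s _; apply: sqr_ge0.
Qed.

Lemma gram_orthogonal i j k l : C4_free E ->
  (i, j) \in E -> (k, l) \in E -> (i, j) != (k, l) ->
  \sum_t C t i j * C t k l = 0.
Proof.
move=> EC4 ijE klE ijkl; have polar := gram_polar ijkl.
have [/orP ikjl|] := boolP ((i == k) || (j == l)).
  suff : 2 * \sum_t C t i j * C t k l = 0 by lra.
  rewrite -[RHS]polar mulr_sumr; apply: eq_bigr => t _.
  by case: ikjl => /eqP->; ring.
rewrite negb_or => /andP[ik jl].
rewrite -[RHS]polar; apply: eq_bigr => t _.
have /nandP[/gram_notin-> | /gram_notin->] := EC4 i j k l ik jl ijE klE; ring.
Qed.

(** [#|E|] orthonormal vectors of R^r, here the columns of [M], force
    [#|E| <= r]. *)
Lemma C4_free_card_le : C4_free E -> (#|E| <= r)%N.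
Proof.
move=> EC4.
pose M : 'M[R]_(r, #|E|) :=
  \matrix_(t, e) C t (enum_val e).1 (enum_val e).2.
have MM : M^T *m M = 1%:M.
  apply/matrixP => e e'; rewrite !mxE; under eq_bigr => t _ do rewrite !mxE.
  have eE := enum_valP e; have eE' := enum_valP e'.
  rewrite -(inj_eq enum_val_inj).
  move: eE eE'; case: (enum_val e) (enum_val e') => [i j] [k l] /= ijE klE.
  have [[<- <-]|/eqP ijkl] := (i, j) =P (k, l).
    by under eq_bigr => t _ do rewrite -expr2; rewrite gram_diag ijE.
  exact: gram_orthogonal.
by rewrite -(mxrank1 R #|E|) -MM (leq_trans (mxrankM_maxr _ _)) ?rank_leq_row.
Qed.

End Gram.

Lemma simple_sum_of_squares (R : realType) (m n : nat) (E : {set 'I_m * 'I_n}) :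
  sum_of_squares (\sum_(e in E) xvar R n e.1 ^+ 2 * yvar R m e.2 ^+ 2) #|E|.
Proof.
apply/sum_of_squaresP.
exists (fun t => delta_mx (enum_val t).1 (enum_val t).2).
rewrite big_enum_val; apply: eq_bigr => t _; rewrite -exprMn; congr (_ ^+ 2).
case: (enum_val t) => i j.
rewrite /bilmx (bigD1 i) //= (bigD1 j) //= !mxE !eqxx.
rewrite scale1r !big1 ?addr0 // => [k ki|l lj].
  by rewrite big1 // => l _; rewrite mxE (negPf ki) scale0r.
by rewrite mxE eqxx (negPf lj) scale0r.
Qed.

Lemma sos_rank_C4_free (R : realType) (m n : nat) (E : {set 'I_m * 'I_n}) :
  C4_free E ->
  sos_rank (\sum_(e in E) xvar R n e.1 ^+ 2 * yvar R m e.2 ^+ 2) = #|E|.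
Proof.
move=> EC4; have PE := simple_sum_of_squares R E.
have [/sum_of_squaresP[C CE] rank_le] := sos_rankP (ex_intro _ _ PE).
by apply/eqP; rewrite eqn_leq rank_le //= (C4_free_card_le CE).
Qed.

Lemma simple_biquadratic (R : realType) (m n : nat) (P : {mpoly R[m + n]}) :
  simple_form P -> biquadratic_form P.
Proof.
move=> [E _ ->].
exists (fun i j k l => ((k == i) && (l == j) && ((i, j) \in E))%:R).
transitivity (\sum_i \sum_j (if (i, j) \in E then
    xvar R n i ^+ 2 * yvar R m j ^+ 2 else 0)).
  by rewrite pair_bigA big_mkcond; apply: eq_bigr => -[].
apply: eq_bigr => i _; rewrite (bigD1 i) //= [X in _ + X]big1 ?addr0.
  apply: eq_bigr => j _; rewrite (bigD1 j) //= big1 ?addr0 => [|l lj].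
    by rewrite !eqxx /= !expr2 mulrA; case: ifP; rewrite ?scale1r ?scale0r.
  by rewrite (negPf lj) andbF scale0r.
move=> k ki; rewrite big1 // => j _; rewrite big1 // => l _.
by rewrite (negPf ki) scale0r.
Qed.

(** * A C4-free graph with m + n edges *)

(** The mates orient the graph: each row and each column selects one incident
    edge.  On the vertices below 3 the edges are the (i, j) with i <> j, a
    6-cycle; any other vertex is pendant to vertex 0 of the other side. *)
Definition hexagon_mate (k : nat) : nat :=
  match k with 0 => 1 | 1 => 2 | _ => 0 end%N.

Definition pendant_hexagon (m n : nat) : {set 'I_m * 'I_n} :=
  [set e : 'I_m * 'I_n |
    (hexagon_mate e.1 == e.2) || (hexagon_mate e.2 == e.1)].

Lemma pendant_hexagon_C4_free m n : C4_free (pendant_hexagon m n).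
Proof.
move=> i j k l; rewrite -!val_eqE !inE /= => ik jl.
case: i j k l ik jl =>
  [[|[|[|i]]] ?] [[|[|[|j]]] ?] [[|[|[|k]]] ?] [[|[|[|l]]] ?] //.
Qed.

(** Sending each vertex to the edge towards its mate is injective, as no vertex
    is the mate of its mate: that is the case for a graph oriented along its
    only cycle and towards it. *)
Lemma card_pendant_hexagon m n : (3 <= m)%N -> (3 <= n)%N ->
  (m + n <= #|pendant_hexagon m n|)%N.
Proof.
move=> hm hn.
have lt3 k : (hexagon_mate k < 3)%N by case: k => [|[|[|k]]].
have ltm k : (hexagon_mate k < m)%N by apply: leq_trans hm.
have ltn k : (hexagon_mate k < n)%N by apply: leq_trans hn.
pose edge (v : 'I_m + 'I_n) : 'I_m * 'I_n :=
  match v with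
  | inl i => (i, Ordinal (ltn i))
  | inr j => (Ordinal (ltm j), j)
  end.
have edge_inj : injective edge.
  have mate2 k : hexagon_mate (hexagon_mate k) != k by case: k => [|[|[|k]]].
  move=> [i|j] [k|l] [] /=.
  - by move=> ->.
  - by move=> -> /(congr1 val)/= lE; have := mate2 l; rewrite lE eqxx.
  - by move=> <- /(congr1 val)/= jE; have := mate2 j; rewrite -jE eqxx.
  - by move=> _ ->.
rewrite -[m in (m + _)%N]card_ord -[n in (_ + n)%N]card_ord -card_sum.
rewrite -(card_codom edge_inj); apply/subset_leq_card/subsetP => e.
by move=> /codomP[[i|j] ->]; rewrite inE eqxx ?orbT.
Qed.

Theorem theorem2p10 (R : realType) (m n : nat) (hm : (3 <= m)%N) (hn : (3 <= n)%N) :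
  (m + n <= BSR_simple R m n)%N /\ (m + n <= BSR R m n)%N.
Proof.
pose E := pendant_hexagon m n; pose P : {mpoly R[m + n]} :=
  \sum_(e in E) xvar R n e.1 ^+ 2 * yvar R m e.2 ^+ 2.
have rankP : sos_rank P = #|E|.
  by apply/sos_rank_C4_free/pendant_hexagon_C4_free.
have cardE : (m + n <= #|E|)%N by apply: card_pendant_hexagon.
have simpleP : simple_form P.
  exists E => //; rewrite -card_gt0; apply: leq_trans cardE.
  by rewrite addn_gt0 (leq_trans _ hm).
split; apply: (leq_trans cardE); apply: (@le_xget_greatest _ (m * n)).
- move=> _ [_ [E' _ ->] <-]; apply: sos_rank_le.
  by exists #|E'|; apply: simple_sum_of_squares.
- by exists P.
- by move=> _ [Q [_ QSOS] <-]; apply: sos_rank_le.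
- exists P => //; split; first exact: simple_biquadratic.
  by exists #|E|; apply: simple_sum_of_squares.
Qed.
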